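(* Let $(V,L)$ be a Lefschetz bundle over a smooth manifold $M$, with Lefschetz star operator $*_s$ and $\Lambda:=*_s^{-1}L*_s$. Let $D$ be a degree preserving connection on $V$ and put $\theta:=[D,L]=DL-LD$. If $[L,\theta]=0$, then $$*_s^{-1}D*_s=D+[\Lambda,\theta].$$
   Context: Lefschetz bundle: $V=\oplus_{k=0}^{2n}V^k$ is a direct sum of complex vector bundles over a smooth manifold $M$, and $L$ is a smooth section of $\mathrm{End}(V)$ such that $L(V^l)\subset V^{l+2}$ for all $0\le l\le 2(n-1)$, $L(V^{2n-1})=L(V^{2n})=0$, and each $L^k:V^{n-k}\to V^{n+k}$, $0\le k\le n$, is an isomorphism. $u\in V^k$ is primitive if $k\le n$ and $L^{n-k+1}u=0$. Put $L_r:=L^r/r!$ for $r\ge 0$ and $L_r:=0$ for $r<0$. Every $u\in V^k$ has a unique (Lefschetz) decomposition $u=\sum_r L_ru^r$ with $u^r\in V^{k-2r}$ primitive. Lefschetz star operator: the $\mathbb{C}$-linear map $*_s:V\to V$ with $*_s(L_ru):=(-1)^{k+(k-1)+\cdots+1}L_{n-r-k}u$ for $u\in V^k$ primitive; it satisfies $*_s^2=1$. ''Degree preserving'' means that $D$ maps sections of $V^k$ to $V^k$-valued one-forms for every $k$. Endomorphisms of $V$ act on $V$-valued one-forms trivially on the form factor. In local coordinates $\{t^j\}$ on $M$, $D=\sum dt^j\otimes D_j$, $\theta=\sum dt^j\otimes\theta_j$ with $\theta_j=[D_j,L]$; the hypothesis means $[L,\theta_j]=0$ for all $j$ and the conclusion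 means $*_s^{-1}D_j*_s=D_j+[\Lambda,\theta_j]$ for all $j$. *)

(* Defs.v *)
From HB Require Import structures.
From mathcomp Require Import all_boot all_order all_algebra.
From mathcomp Require Import complex.
From mathcomp Require Import all_classical all_reals all_analysis.
Import Order.TTheory GRing.Theory Num.Theory numFieldNormedType.Exports.

Set Implicit Arguments.
Unset Strict Implicit.
Unset Printing Implicit Defensive.

Local Open Scope classical_set_scope.
Local Open Scope ring_scope.

Section SmoothEuclidean.
Variables (R : realType) (m : nat).

(* Meaningful for [U] open: all iterated partial derivatives of [f] of order
   at most [k] exist and are continuous on [U]. *)
Fixpoint Ck_on (U : set 'rV[R]_m) (k : nat) (f : 'rV[R]_m -> R) : Prop :=
  (forall x, U x -> {for x, continuous f}) /\
  (if k is k'.+1 then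
     forall j : 'I_m,
       (forall x, U x -> derivable f x (delta_mx 0 j)) /\
       Ck_on U k' ('D_(delta_mx 0 j) f)
   else True).

Definition Cinfty_on U f := forall k, Ck_on U k f.

End SmoothEuclidean.

(* [chart_inv] is a total function; only its values on the image of
   [chart_dom] are constrained. *)
Record chart (R : realType) (m : nat) (M : topologicalType) := Chart {
  chart_dom : set M;
  chart_map : M -> 'rV[R]_m;
  chart_inv : 'rV[R]_m -> M;
  chart_dom_open : open chart_dom;
  chart_img_open : open (chart_map @` chart_dom);
  chart_mapK : forall x, chart_dom x -> chart_inv (chart_map x) = x;
  chart_map_cont : forall x, chart_dom x -> {for x, continuous chart_map};
  chart_inv_cont : forall y, (chart_map @` chart_dom) y ->
    {for y, continuous chart_inv} }.

Record manifold (R : realType) (m : nat) := Manifold {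
  mfd_carrier :> topologicalType;
  mfd_hausdorff : hausdorff_space mfd_carrier;
  mfd_second_countable : @second_countable mfd_carrier;
  mfd_atlas : set (chart R m mfd_carrier);
  mfd_cover : forall x, exists2 c, mfd_atlas c & chart_dom c x;
  mfd_compat : forall c d, mfd_atlas c -> mfd_atlas d ->
    forall j : 'I_m,
      Cinfty_on (chart_map c @` (chart_dom c `&` chart_dom d))
        (fun y => chart_map d (chart_inv c y) 0 j) }.

Section Functions.
Variables (R : realType) (m : nat) (M : manifold R m).

(* Smoothness on an open subset [W] of [M]. *)
Definition smooth_fun_on (W : set M) (f : M -> R) : Prop :=
  forall c : chart R m M, mfd_atlas c ->
    Cinfty_on (chart_map c @` (chart_dom c `&` W)) (f \o chart_inv c).

Definition smooth_cfun_on (W : set M) (f : M -> R[i]) : Prop :=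
  smooth_fun_on W (fun x => complex.Re (f x)) /\
  smooth_fun_on W (fun x => complex.Im (f x)).

Definition smooth_fun (f : M -> R) := smooth_fun_on [set: M] f.
Definition smooth_cfun (f : M -> R[i]) := smooth_cfun_on [set: M] f.

(* Tangent vectors at [p] are the derivations at [p] of the algebra of smooth
   functions.  The values on non-smooth functions are irrelevant: two tangent
   vectors have to be identified when they agree on smooth functions. *)
Record tangent (p : M) := Tangent {
  tangent_fun :> (M -> R) -> R;
  tangent_linear : forall (a : R) f g, smooth_fun f -> smooth_fun g ->
    tangent_fun (fun x => a * f x + g x) = a * tangent_fun f + tangent_fun g;
  tangent_leibniz : forall f g, smooth_fun f -> smooth_fun g ->
    tangent_fun (fun x => f x * g x) = tangent_fun f * g p + f p * tangent_fun g }.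

Definition smooth_vector_field (X : forall p : M, tangent p) : Prop :=
  forall f, smooth_fun f -> smooth_fun (fun p => X p f).

Definition cdiff (f : M -> R[i]) (p : M) (v : tangent p) : R[i] :=
  Complex (v (fun x => complex.Re (f x))) (v (fun x => complex.Im (f x))).

End Functions.

(* Local frame, over [frame_dom], of a family of finite-dimensional complex
   vector spaces; it encodes a local trivialization. *)
Record frame (R : realType) (m : nat) (M : manifold R m)
    (E : M -> vectType R[i]) := Frame {
  frame_dom : set M;
  frame_rank : nat;
  frame_vec : forall x : M, frame_rank.-tuple (E x) }.

Record cvbundle (R : realType) (m : nat) (M : manifold R m) := CVBundle {
  fiber :> M -> vectType R[i];
  bdl_frames : set (frame fiber);
  bdl_frame_open : forall e, bdl_frames e -> open (frame_dom e);
  bdl_frame_basis : forall e, bdl_frames e ->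
    forall x, frame_dom e x -> basis_of fullv (frame_vec e x);
  bdl_cover : forall x, exists2 e, bdl_frames e & frame_dom e x;
  bdl_compat : forall e e', bdl_frames e -> bdl_frames e' ->
    forall (i : 'I_(frame_rank e)) (j : 'I_(frame_rank e')),
      smooth_cfun_on (frame_dom e `&` frame_dom e')
        (fun x => coord (frame_vec e x) i (tnth (frame_vec e' x) j)) }.

Section BundleNotions.
Variables (R : realType) (m : nat) (M : manifold R m) (V : cvbundle M).

Definition section := forall x : M, V x.
Definition endo := forall x : M, 'End(V x).
Definition form1 := forall x : M, tangent x -> V x.

Definition smooth_section_on (W : set M) (s : section) : Prop :=
  forall e, bdl_frames e -> forall i : 'I_(frame_rank e),
    smooth_cfun_on (W `&` frame_dom e)
      (fun x => coord (frame_vec e x) i (s x)).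

Definition smooth_section (s : section) := smooth_section_on [set: M] s.

Definition smooth_endo (A : endo) : Prop :=
  forall e, bdl_frames e -> forall j : 'I_(frame_rank e),
    smooth_section_on (frame_dom e) (fun x => A x (tnth (frame_vec e x) j)).

Definition subbundle (G : forall x : M, {vspace V x}) : Prop :=
  forall p : M, exists e : frame V,
    [/\ open (frame_dom e), frame_dom e p,
        forall x, frame_dom e x -> basis_of (G x) (frame_vec e x) &
        forall j : 'I_(frame_rank e),
          smooth_section_on (frame_dom e) (fun x => tnth (frame_vec e x) j)].

(* The linearity clause is phrased relationally, so that it also forces the
   value of the form to depend only on the values of the tangent vector on
   smooth functions. *)
Definition smooth_form1 (w : form1) : Prop :=
  (forall (x : M) (a : R) (u v t : tangent x),
     (forall f, smooth_fun f -> t f = a * u f + v f) ->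
     w x t = (real_complex R a) *: w x u + w x v) /\
  (forall X, smooth_vector_field X -> smooth_section (fun x => w x (X x))).

(* An operator from sections to V-valued one-forms is a total function, of
   which only the restriction to smooth sections matters. *)
Definition operator := section -> form1.

Definition connection (D : operator) : Prop :=
  [/\ forall s, smooth_section s -> smooth_form1 (D s),
      forall (a : R[i]) s t, smooth_section s -> smooth_section t ->
        forall (x : M) (v : tangent x),
          D (fun y => a *: s y + t y) x v = a *: D s x v + D t x v &
      forall f s, smooth_cfun f -> smooth_section s ->
        forall (x : M) (v : tangent x),
          D (fun y => f y *: s y) x v = cdiff f v *: s x + f x *: D s x v].

(* Composition with endomorphisms, which act trivially on the form factor. *)
Definition endo_comp (A : endo) (T : operator) : operator :=
  fun s x v => A x (T s x v).
Definition comp_endo (T : operator) (A : endo) : operator :=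
  fun s => T (fun y => A y (s y)).

Definition op_add (S T : operator) : operator :=
  fun s x v => S s x v + T s x v.
Definition op_sub (S T : operator) : operator :=
  fun s x v => S s x v - T s x v.
Definition op_zero : operator := fun s x v => 0.

Definition op_eq (S T : operator) : Prop :=
  forall s, smooth_section s ->
    forall (x : M) (v : tangent x), S s x v = T s x v.

Definition brk_op_endo (T : operator) (A : endo) : operator :=
  op_sub (comp_endo T A) (endo_comp A T).
Definition brk_endo_op (A : endo) (T : operator) : operator :=
  op_sub (endo_comp A T) (comp_endo T A).

Definition endo_inv (A : endo) : endo := fun x => (A x)^-1%VF.
Definition endo_mul (A B : endo) : endo := fun x => (A x \o B x)%VF.

End BundleNotions.

(* [lef_gr k] is the summand of degree [k]; it is only relevant for
   [k <= 2 * n]. *)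
Record lefschetz_bundle (R : realType) (m : nat) (M : manifold R m) (n : nat) :=
  LefschetzBundle {
  lef_bdl :> cvbundle M;
  lef_gr : nat -> forall x : M, {vspace lef_bdl x};
  lef_gr_subbundle : forall k, (k <= n.*2)%N -> subbundle (lef_gr k);
  lef_gr_direct : forall x, directv (\sum_(k < n.*2.+1) lef_gr k x)%VS;
  lef_gr_full : forall x, (\sum_(k < n.*2.+1) lef_gr k x)%VS = fullv;
  lef_op : endo lef_bdl;
  lef_op_smooth : smooth_endo lef_op;
  lef_op_degree : forall l x u, (l.+2 <= n.*2)%N ->
    u \in lef_gr l x -> lef_op x u \in lef_gr l.+2 x;
  lef_op_top : forall l x u, (l.+1 == n.*2) || (l == n.*2) ->
    u \in lef_gr l x -> lef_op x u = 0;
  lef_op_iso : forall k x, (k <= n)%N ->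
    set_bij [set` lef_gr (n - k) x] [set` lef_gr (n + k) x]
      (iter k (lef_op x)) }.

Arguments lef_gr {R m M n} _ _ _.
Arguments lef_op {R m M n} _ _.

Section Lefschetz.
Variables (R : realType) (m : nat) (M : manifold R m) (n : nat).
Variable V : lefschetz_bundle M n.

Definition primitive (k : nat) (x : M) (u : V x) : Prop :=
  [/\ u \in lef_gr V k x, (k <= n)%N & iter (n - k).+1 (lef_op V x) u = 0].

Definition lef_divpow (r : int) (x : M) (u : V x) : V x :=
  if r is Posz j then (j`!%:R)^-1 *: iter j (lef_op V x) u else 0.

(* By the Lefschetz decomposition this determines [star]. *)
Definition lefschetz_star (star : endo V) : Prop :=
  forall (k : nat) (x : M) (u : V x), primitive k u ->
    forall r : int,
      star x (lef_divpow r u) =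
      (-1) ^+ (\sum_(1 <= i < k.+1) i)%N *:
        lef_divpow (n%:Z - r - k%:Z) u.

Definition degree_preserving (D : operator V) : Prop :=
  forall (k : nat) (s : section V), (k <= n.*2)%N -> smooth_section s ->
    (forall x, s x \in lef_gr V k x) ->
    forall (x : M) (v : tangent x), D s x v \in lef_gr V k x.

Definition dual_lefschetz (star : endo V) : endo V :=
  endo_mul (endo_inv star) (endo_mul (lef_op V) star).

End Lefschetz.

(* Main.v *)
Require Import Defs.
From HB Require Import structures.
From mathcomp Require Import all_boot all_order all_algebra.
From mathcomp Require Import zify ring.
From mathcomp Require Import complex.
From mathcomp Require Import all_classical all_reals all_analysis.

(** The operators being compared are applied to sections of [V], and both
sides are additive on smooth sections, so it is enough to check the identity
on sections [L_r u] with [u] smooth and primitive of degree [k], for one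
tangent vector [v] at one point [x].

Put [N = n - k] and write [D] and [theta] for their values along [v].  The
form of [D u] and [theta u] is forced by a degree count
([variation_split]).  Since [theta] commutes with [L],
  [D (L^(N+1) u) = L^(N+1) (D u) + (N+1) L^N (theta u)],
and both this and [theta (L^(N+1) u) = L^(N+1) (theta u)] vanish because
[L^(N+1) u = 0].  Decomposing [D u], of degree [k], and [theta u], of degree
[k+2], into primitive parts, the injectivity of the powers of [L] below the
middle degree leaves only
  [theta u = b0 + L b1 + L^2 b2],   [D u = a0 - (N+1) L b2],
with [b0], [a0] and [b1], [b2] primitive of degrees [k+2], [k], [k-2].
On a primitive vector of degree [j] the star operator is
[L_r w |-> e_j L_(n-j-r) w] with a sign [e_j] satisfying [e_(j+2) = - e_j], so
both sides of the identity are explicit combinations of [L_r a0],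
[L_(r-1) b0], [L_r b1] and [L_(r+1) b2]; the coefficients agree
([conjugation_divpow]).

The remaining work is analytic.  [D] is constrained only on smooth sections,
so the Lefschetz decomposition of a smooth section has to have smooth
components, whence also the star operator preserves smoothness.  Near a point,
choose frames of the summands of degree at most [n] and transport them by
powers of [L] to the summands of higher degree.  This gives a smooth frame of
[V] adapted to the grading, in which projecting onto [V^k] and inverting
[L^j : V^(n-j) -> V^(n+j)] have constant matrices.  The coordinates of a smooth
section in any smooth frame are smooth by the formula for the inverse of a
matrix, hence by the closure of smooth functions under sums, products and
inverses ([smooth_coord_fiberwise_basis], [adapted_decomposition]). *)

Import Order.TTheory GRing.Theory Num.Theory numFieldNormedType.Exports.

Set Implicit Arguments.
Unset Strict Implicit.
Unset Printing Implicit Defensive.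
Local Open Scope classical_set_scope.
Local Open Scope ring_scope.

(** * Smooth functions *)

Section EuclideanCalculus.
Variables (R : realType) (m : nat).
Implicit Types (U : set 'rV[R]_m) (f g : 'rV[R]_m -> R) (y : 'rV[R]_m).

(** Regularity on [U] is a condition at each point of [U]: this makes all
gluing of locally smooth objects immediate. *)
Lemma Ck_on_point U k f :
  Ck_on U k f <-> forall y, U y -> Ck_on [set y] k f.
Proof.
elim: k f => [|k IH] f /=.
  split=> [[cf _] y Uy|cf].
    by split=> // _ ->; apply: cf.
  by split=> // x Ux; have [+ _] := cf _ Ux; apply.
split=> [[cf Df] y Uy|H].
  split=> [_ -> |j]; first exact: cf.
  have [dj /IH Dj] := Df j.
  by split=> [_ -> |]; [exact: dj | exact: Dj].
split=> [x Ux|j]; first by have [+ _] := H _ Ux; apply.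
split=> [x Ux|]; first by have [_ /(_ j)[+ _]] := H _ Ux; apply.
by apply/IH => y Uy; have [_ /(_ j)[]] := H _ Uy.
Qed.

Lemma continuous_at_near y f g :
  (\near y, f y = g y) -> {for y, continuous f} -> {for y, continuous g}.
Proof.
move=> fg; rewrite /prop_for /continuous_at -(nbhs_singleton fg) => cf.
exact: cvg_trans (near_eq_cvg fg) cf.
Qed.

(** Only the germ of [f] at [y] matters, since functions that agree near [y]
also agree near every nearby point. *)
Lemma Ck_on_near y k f g :
  (\near y, f y = g y) -> Ck_on [set y] k f -> Ck_on [set y] k g.
Proof.
elim: k f g => [|k IH] f g fg /= -[cf Df]; split=> //.
- by move=> _ ->; exact: continuous_at_near fg (cf y erefl).
- by move=> _ ->; exact: continuous_at_near fg (cf y erefl).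
move=> j; have [df Ckf] := Df j; split=> [_ -> |].
  by apply: (near_eq_derivable fg); apply: df.
apply: IH Ckf.
apply: filterS (nbhs_interior fg) => z fgz.
exact: near_eq_derive.
Qed.

Lemma Ck_on_eq U k f g :
  open U -> {in U, f =1 g} -> Ck_on U k f -> Ck_on U k g.
Proof.
move=> Uo fg /Ck_on_point Cf; apply/Ck_on_point => y Uy.
apply: Ck_on_near (Cf _ Uy).
near=> z; apply: fg; rewrite inE.
by near: z; apply: open_nbhs_nbhs.
Unshelve. all: by end_near. Qed.

Lemma Ck_onW U k f : Ck_on U k.+1 f -> Ck_on U k f.
Proof.
elim: k f => [|k IH] f; first by case.
move=> [cf Df]; split=> // j; have [df Ckf] := Df j; split=> //.
exact: IH.
Qed.

Lemma Ck_on_cst U k (a : R) : Ck_on U k (fun=> a).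
Proof.
elim: k a => [|k IH] a /=; (split=> [x _|]; [exact: cst_continuous|]) => // j.
split=> [x _|]; first exact: derivable_cst.
have -> : 'D_(delta_mx 0 j) (fun=> a) = (fun=> 0) :> ('rV[R]_m -> R).
  by apply/funext => x; exact: derive_cst.
exact: IH.
Qed.

Lemma Ck_on_add U k f g :
  open U -> Ck_on U k f -> Ck_on U k g -> Ck_on U k (fun x => f x + g x).
Proof.
move=> Uo; elim: k f g => [|k IH] f g [cf Df] [cg Dg].
  by split=> // x Ux; apply: continuousD; [apply: cf | apply: cg].
split=> [x Ux|j].
  by apply: continuousD; [apply: cf | apply: cg].
have [df Cf] := Df j; have [dg Cg] := Dg j; split=> [x Ux|].
  by apply: derivableD; [apply: df | apply: dg].
apply: Ck_on_eq (IH _ _ Cf Cg) => // x; rewrite inE => Ux.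
by apply/esym/deriveD; [apply: df | apply: dg].
Qed.

Lemma Ck_on_mul U k f g :
  open U -> Ck_on U k f -> Ck_on U k g -> Ck_on U k (fun x => f x * g x).
Proof.
move=> Uo; elim: k f g => [|k IH] f g Cf Cg.
  have [cf _] := Cf; have [cg _] := Cg.
  by split=> // x Ux; apply: continuousM; [apply: cf | apply: cg].
have [cf Df] := Cf; have [cg Dg] := Cg.
split=> [x Ux|j].
  by apply: continuousM; [apply: cf | apply: cg].
have [df Cdf] := Df j; have [dg Cdg] := Dg j; split=> [x Ux|].
  by apply: derivableM; [apply: df | apply: dg].
apply: Ck_on_eq (Ck_on_add Uo (IH _ _ (Ck_onW Cf) Cdg)
                              (IH _ _ (Ck_onW Cg) Cdf)) => // x.
rewrite inE => Ux.
by apply/esym/deriveM; [apply: df | apply: dg].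
Qed.

(** Induction on [k]: the derivative [- f^-1 * f^-1 * f'] involves [f^-1]
itself, with one order of regularity less. *)
Lemma Ck_on_inv U k f :
  open U -> (forall x, U x -> f x != 0) -> Ck_on U k f ->
  Ck_on U k (fun x => (f x)^-1).
Proof.
move=> Uo f0; elim: k => [|k IH] Cf.
  have [cf _] := Cf.
  by split=> // x Ux; apply: continuousV; [apply: f0 | apply: cf].
have [cf Df] := Cf; split=> [x Ux|j].
  by apply: continuousV; [apply: f0 | apply: cf].
have [df Cdf] := Df j; split=> [x Ux|].
  by apply: derivableV; [apply: f0 | apply: df].
have CV := IH (Ck_onW Cf).
apply: Ck_on_eq (Ck_on_mul Uo (Ck_on_cst U k (-1))
  (Ck_on_mul Uo (Ck_on_mul Uo CV CV) Cdf)) => // x; rewrite inE => Ux.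
rewrite deriveV; [|exact: f0|exact: df].
by rewrite mulN1r -mulNr -invfM -expr2.
Qed.

End EuclideanCalculus.

Section ManifoldCalculus.
Variables (R : realType) (m : nat) (M : manifold R m).
Implicit Types (W : set M) (f g : M -> R).

(** A chart is open on its domain because its inverse is continuous. *)
Lemma chart_image_open (c : chart R m M) W :
  open W -> open (chart_map c @` (chart_dom c `&` W)).
Proof.
move=> Wo; rewrite openE => _ [x [cx Wx] <-]; rewrite /interior.
have img : (chart_map c @` chart_dom c) (chart_map c x) by exists x.
have near1 : \forall y \near chart_map c x, (chart_map c @` chart_dom c) y.
  by apply: open_nbhs_nbhs; split=> //; exact: chart_img_open.
have near2 : \forall y \near chart_map c x, W (chart_inv c y).
  apply: (chart_inv_cont img).
  by rewrite chart_mapK //; apply: open_nbhs_nbhs.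
near=> y.
have [z cz zy] : (chart_map c @` chart_dom c) y by near: y.
have Wz : W (chart_inv c y) by near: y.
by exists z => //; split=> //; rewrite -(chart_mapK cz) zy.
Unshelve. all: by end_near. Qed.

Lemma smooth_fun_on_point W f :
  smooth_fun_on W f <-> forall p, W p -> smooth_fun_on [set p] f.
Proof.
split=> [sf p Wp c ac k|sf c ac k]; apply/Ck_on_point.
  move=> _ [x [+ xp] <-]; rewrite (xp : x = p) => cp.
  by have /Ck_on_point := sf c ac k; apply; exists p.
move=> _ [p [cp Wp] <-].
by have /Ck_on_point := sf p Wp c ac k; apply; exists p.
Qed.

Lemma smooth_fun_on_eq W f g :
  open W -> {in W, f =1 g} -> smooth_fun_on W f -> smooth_fun_on W g.
Proof.
move=> Wo fg sf c ac k; apply: Ck_on_eq (sf c ac k).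
  exact: chart_image_open.
move=> y; rewrite inE => -[x [cx Wx] <-] /=.
by rewrite chart_mapK //; apply: fg; rewrite inE.
Qed.

Lemma smooth_fun_on_cst W (a : R) : smooth_fun_on W (fun=> a).
Proof. by move=> c ac k; exact: Ck_on_cst. Qed.

Lemma smooth_fun_on_add W f g : open W ->
  smooth_fun_on W f -> smooth_fun_on W g ->
  smooth_fun_on W (fun x => f x + g x).
Proof.
move=> Wo sf sg c ac k; have Uo := chart_image_open (c := c) Wo.
exact: (Ck_on_add Uo (sf c ac k) (sg c ac k)).
Qed.

Lemma smooth_fun_on_mul W f g : open W ->
  smooth_fun_on W f -> smooth_fun_on W g ->
  smooth_fun_on W (fun x => f x * g x).
Proof.
move=> Wo sf sg c ac k; have Uo := chart_image_open (c := c) Wo.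
exact: (Ck_on_mul Uo (sf c ac k) (sg c ac k)).
Qed.

Lemma smooth_fun_on_inv W f : open W -> (forall x, W x -> f x != 0) ->
  smooth_fun_on W f -> smooth_fun_on W (fun x => (f x)^-1).
Proof.
move=> Wo f0 sf c ac k; have Uo := chart_image_open (c := c) Wo.
apply: (Ck_on_inv Uo _ (sf c ac k)) => _ [x [cx Wx] <-] /=.
by rewrite chart_mapK //; exact: f0.
Qed.

Lemma smooth_fun_on_opp W f : open W ->
  smooth_fun_on W f -> smooth_fun_on W (fun x => - f x).
Proof.
move=> Wo sf; apply: smooth_fun_on_eq
  (smooth_fun_on_mul Wo (smooth_fun_on_cst W (-1)) sf) => //.
by move=> x _ /=; rewrite mulN1r.
Qed.

Implicit Types F G : M -> R[i].

Lemma smooth_cfun_on_point W F :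
  smooth_cfun_on W F <-> forall p, W p -> smooth_cfun_on [set p] F.
Proof.
split=> [[/smooth_fun_on_point re /smooth_fun_on_point im] p Wp|H].
  by split; [exact: re | exact: im].
by split; apply/smooth_fun_on_point => p /H[].
Qed.

Lemma smooth_cfun_onW W W' F :
  W' `<=` W -> smooth_cfun_on W F -> smooth_cfun_on W' F.
Proof.
by move=> sW /smooth_cfun_on_point H; apply/smooth_cfun_on_point => p /sW/H.
Qed.

Lemma smooth_cfun_on_local W F :
  (forall p, W p -> exists W', [/\ open W', W' p & smooth_cfun_on (W' `&` W) F]) ->
  smooth_cfun_on W F.
Proof.
move=> H; apply/smooth_cfun_on_point => p Wp; have [W' [_ W'p]] := H p Wp.
by apply: smooth_cfun_onW => _ ->.
Qed.

Lemma smooth_cfun_on_eq W F G :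
  open W -> {in W, F =1 G} -> smooth_cfun_on W F -> smooth_cfun_on W G.
Proof.
move=> Wo FG [re im]; split.
  by apply: smooth_fun_on_eq re => // x xW /=; rewrite FG.
by apply: smooth_fun_on_eq im => // x xW /=; rewrite FG.
Qed.

Lemma smooth_cfun_on_cst W (a : R[i]) : smooth_cfun_on W (fun=> a).
Proof. by split; exact: smooth_fun_on_cst. Qed.

Lemma smooth_cfun_on_add W F G : open W ->
  smooth_cfun_on W F -> smooth_cfun_on W G ->
  smooth_cfun_on W (fun x => F x + G x).
Proof.
move=> Wo [reF imF] [reG imG]; split.
  by apply: smooth_fun_on_eq (smooth_fun_on_add Wo reF reG) => // x _ /=;
     case: (F x); case: (G x).
by apply: smooth_fun_on_eq (smooth_fun_on_add Wo imF imG) => // x _ /=;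
     case: (F x); case: (G x).
Qed.

Lemma smooth_cfun_on_mul W F G : open W ->
  smooth_cfun_on W F -> smooth_cfun_on W G ->
  smooth_cfun_on W (fun x => F x * G x).
Proof.
move=> Wo [reF imF] [reG imG]; split.
  apply: smooth_fun_on_eq (smooth_fun_on_add Wo (smooth_fun_on_mul Wo reF reG)
    (smooth_fun_on_opp Wo (smooth_fun_on_mul Wo imF imG))) => // x _ /=.
  by case: (F x); case: (G x).
apply: smooth_fun_on_eq (smooth_fun_on_add Wo (smooth_fun_on_mul Wo reF imG)
    (smooth_fun_on_mul Wo imF reG)) => // x _ /=.
by case: (F x); case: (G x).
Qed.

Lemma smooth_cfun_on_inv W F : open W -> (forall x, W x -> F x != 0) ->
  smooth_cfun_on W F -> smooth_cfun_on W (fun x => (F x)^-1).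
Proof.
move=> Wo F0 [re im].
have sN := smooth_fun_on_inv (f := fun x =>
  complex.Re (F x) * complex.Re (F x) + complex.Im (F x) * complex.Im (F x)) Wo.
have {}sN : smooth_fun_on W (fun x => (complex.Re (F x) * complex.Re (F x)
    + complex.Im (F x) * complex.Im (F x))^-1).
  apply: sN; last by apply: smooth_fun_on_add => //; apply: smooth_fun_on_mul.
  move=> x /F0; case: (F x) => a b /=; rewrite -!expr2 eq_complex /=.
  by rewrite paddr_eq0 ?sqr_ge0 // !sqrf_eq0.
split.
  apply: smooth_fun_on_eq (smooth_fun_on_mul Wo re sN) => // x _ /=.
  by case: (F x) => a b /=; rewrite -!expr2.
apply: smooth_fun_on_eq (smooth_fun_on_opp Wo (smooth_fun_on_mul Wo im sN)) => // x _ /=.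
by case: (F x) => a b /=; rewrite -!expr2 ?mulNr.
Qed.

Lemma smooth_cfun_on_sum W (I : Type) (r : seq I) (P : pred I) (F : I -> M -> R[i]) :
  open W -> (forall i, smooth_cfun_on W (F i)) ->
  smooth_cfun_on W (fun x => \sum_(i <- r | P i) F i x).
Proof.
move=> Wo sF; elim: r => [|i r IH].
  by under eq_fun do rewrite big_nil; exact: smooth_cfun_on_cst.
under eq_fun do rewrite big_cons.
by case: (P i) => //; apply: smooth_cfun_on_add.
Qed.

Lemma smooth_cfun_on_prod W (I : Type) (r : seq I) (P : pred I) (F : I -> M -> R[i]) :
  open W -> (forall i, smooth_cfun_on W (F i)) ->
  smooth_cfun_on W (fun x => \prod_(i <- r | P i) F i x).
Proof.
move=> Wo sF; elim: r => [|i r IH].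
  by under eq_fun do rewrite big_nil; exact: smooth_cfun_on_cst.
under eq_fun do rewrite big_cons.
by case: (P i) => //; apply: smooth_cfun_on_mul.
Qed.

Lemma smooth_cfun_on_det W N (A : M -> 'M[R[i]]_N) : open W ->
  (forall i j, smooth_cfun_on W (fun x => A x i j)) ->
  smooth_cfun_on W (fun x => \det (A x)).
Proof.
move=> Wo sA; apply: smooth_cfun_on_sum => // s; apply: smooth_cfun_on_mul => //.
  exact: smooth_cfun_on_cst.
by apply: smooth_cfun_on_prod.
Qed.

(** The inverse is the adjugate divided by the determinant, both polynomial in
the entries. *)
Lemma smooth_cfun_on_invmx W N (A : M -> 'M[R[i]]_N) : open W ->
  (forall x, W x -> A x \in unitmx) ->
  (forall i j, smooth_cfun_on W (fun x => A x i j)) ->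
  forall i j, smooth_cfun_on W (fun x => invmx (A x) i j).
Proof.
move=> Wo uA sA i j.
have sadj : smooth_cfun_on W (fun x => (\adj (A x)) i j).
  under eq_fun do rewrite mxE.
  apply: smooth_cfun_on_mul => //; first exact: smooth_cfun_on_cst.
  apply: smooth_cfun_on_det => // a b.
  by under eq_fun do rewrite !mxE.
have sdet : smooth_cfun_on W (fun x => (\det (A x))^-1).
  by apply: smooth_cfun_on_inv => //; exact: smooth_cfun_on_det.
apply: smooth_cfun_on_eq (smooth_cfun_on_mul Wo sdet sadj) => // x.
by rewrite inE => /uA Au; rewrite /invmx Au [RHS]mxE.
Qed.

End ManifoldCalculus.

(** * Smooth sections and change of frame *)

Section Sections.
Variables (R : realType) (m : nat) (M : manifold R m) (V : cvbundle M).
Implicit Types (W : set M) (s t : section V) (e : frame V).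

Lemma smooth_section_onW W W' s :
  W' `<=` W -> smooth_section_on W s -> smooth_section_on W' s.
Proof.
move=> sW H e eV i; apply: smooth_cfun_onW (H e eV i).
by move=> x [/sW Wx ex].
Qed.

Lemma smooth_section_on_local W s :
  (forall p, W p -> exists W', [/\ open W', W' p & smooth_section_on (W' `&` W) s]) ->
  smooth_section_on W s.
Proof.
move=> H e eV i; apply: smooth_cfun_on_local => p [Wp ep].
have [W' [Wo W'p sW]] := H p Wp; exists W'; split=> //.
by rewrite setIA; exact: sW.
Qed.

Lemma smooth_section_on_eq W s t :
  open W -> (forall x, W x -> s x = t x) ->
  smooth_section_on W s -> smooth_section_on W t.
Proof.
move=> Wo st ss e eV i; apply: smooth_cfun_on_eq (ss e eV i).
  by apply: openI => //; exact: bdl_frame_open.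
by move=> x; rewrite inE => -[/st -> _].
Qed.

Lemma smooth_section_on_0 W : smooth_section_on W (fun x => 0 : V x).
Proof.
move=> e eV i; under eq_fun do rewrite linear0; exact: smooth_cfun_on_cst.
Qed.

Lemma smooth_section_on_add W s t : open W ->
  smooth_section_on W s -> smooth_section_on W t ->
  smooth_section_on W (fun x => s x + t x).
Proof.
move=> Wo ss st e eV i; under eq_fun do rewrite linearD.
apply: smooth_cfun_on_add; [|exact: ss|exact: st].
by apply: openI => //; exact: bdl_frame_open.
Qed.

Lemma smooth_section_on_scale W (c : M -> R[i]) s : open W ->
  smooth_cfun_on W c -> smooth_section_on W s ->
  smooth_section_on W (fun x => c x *: s x).
Proof.
move=> Wo sc ss e eV i; under eq_fun do rewrite linearZ /=.
apply: smooth_cfun_on_mul; last exact: ss.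
  by apply: openI => //; exact: bdl_frame_open.
by apply: smooth_cfun_onW sc => x [].
Qed.

Lemma smooth_section_on_sum W (I : Type) (r : seq I) (P : pred I)
    (s : I -> section V) : open W ->
  (forall i, P i -> smooth_section_on W (s i)) ->
  smooth_section_on W (fun x => \sum_(i <- r | P i) s i x).
Proof.
move=> Wo ss; elim: r => [|i r IH].
  apply: (smooth_section_on_eq Wo) (@smooth_section_on_0 W) => x _.
  by rewrite big_nil.
case Pi: (P i); last first.
  by apply: (smooth_section_on_eq Wo) IH => x _; rewrite big_cons Pi.
apply: (smooth_section_on_eq Wo) (smooth_section_on_add Wo (ss i Pi) IH) => x _.
by rewrite big_cons Pi.
Qed.

Lemma frame_expand e x (v : V x) : bdl_frames e -> frame_dom e x ->
  v = \sum_j coord (frame_vec e x) j v *: tnth (frame_vec e x) j.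
Proof.
move=> eV ex.
rewrite {1}(coord_basis (bdl_frame_basis eV ex) (memvf v)).
by apply: eq_bigr => j _; rewrite (tnth_nth 0).
Qed.

Lemma smooth_section_on_endo (A : endo V) W s : smooth_endo A -> open W ->
  smooth_section_on W s -> smooth_section_on W (fun x => A x (s x)).
Proof.
move=> sA Wo ss; apply: smooth_section_on_local => p Wp.
have [e eV ep] := bdl_cover V p.
exists (frame_dom e); split=> //; first exact: bdl_frame_open.
have Uo : open (frame_dom e `&` W) by apply: openI => //; exact: bdl_frame_open.
have S : smooth_section_on (frame_dom e `&` W)
   (fun x => \sum_j coord (frame_vec e x) j (s x) *: A x (tnth (frame_vec e x) j)).
  apply: smooth_section_on_sum => // j _; apply: smooth_section_on_scale => //.
    by rewrite setIC; exact: ss.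
  by apply: smooth_section_onW (sA e eV j) => x [].
apply: (smooth_section_on_eq Uo) S => x [ex _].
rewrite [in RHS](frame_expand (s x) eV ex) linear_sum.
by apply: eq_bigr => j _; rewrite linearZ.
Qed.

(** Cramer's rule: smooth sections that form a basis of each fibre form a frame
in which smooth sections have smooth coordinates.  The frame [e] serves to
express everything by matrices, and the point [p] to compare [K] with the
rank. *)
Lemma smooth_coord_fiberwise_basis e W p K (h : 'I_K -> section V) s :
  bdl_frames e -> open W -> W `<=` frame_dom e -> W p ->
  (forall j, smooth_section_on W (h j)) ->
  (forall x, W x -> forall v : V x, exists c, v = \sum_j c j *: h j x) ->
  (forall x, W x -> forall c, \sum_j c j *: h j x = 0 -> forall j, c j = 0) ->
  smooth_section_on W s ->
  exists2 c : 'I_K -> M -> R[i], forall j, smooth_cfun_on W (c j) &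
    forall x, W x -> s x = \sum_j c j x *: h j x.
Proof.
move=> eV Wo We Wp sh span indep ss.
pose A x : 'M[R[i]]_(K, frame_rank e) :=
  \matrix_(j, i) coord (frame_vec e x) i (h j x).
pose cf x (v : V x) : 'rV[R[i]]_(frame_rank e) :=
  \row_i coord (frame_vec e x) i v.
have cfE x (v : V x) : W x -> v = \sum_i cf x v 0 i *: tnth (frame_vec e x) i.
  move=> Wx; rewrite {1}(frame_expand v eV (We _ Wx)).
  by apply: eq_bigr => i _; rewrite mxE.
have cf_mul x (c : 'rV[R[i]]_K) : cf x (\sum_j c 0 j *: h j x) = c *m A x.
  apply/rowP => i; rewrite !mxE linear_sum; apply: eq_bigr => j _.
  by rewrite linearZ mxE.
have cf_tnth x i : W x -> cf x (tnth (frame_vec e x) i) = delta_mx 0 i.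
  move=> Wx; apply/rowP => j; rewrite !mxE (tnth_nth 0) coord_free 1?eq_sym //.
  exact/basis_free/bdl_frame_basis/We.
have full x : W x -> row_full (A x).
  move=> Wx; rewrite -sub1mx; apply/row_subP => i; rewrite rowE mulmx1.
  have [c Ec] := span x Wx (tnth (frame_vec e x) i).
  rewrite -(cf_tnth x i Wx) Ec.
  have -> : \sum_j c j *: h j x = \sum_j (\row_j c j) 0 j *: h j x.
    by apply: eq_bigr => j _; rewrite mxE.
  by rewrite cf_mul submxMl.
have free x : W x -> row_free (A x).
  move=> Wx; apply: inj_row_free => c; rewrite -cf_mul => c0.
  apply/rowP => j; rewrite [RHS]mxE; apply: (indep x Wx (fun j => c 0 j)).
  rewrite [LHS](cfE x) // c0; apply: big1 => i _.
  by rewrite mxE scale0r.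
have EK : K = frame_rank e.
  by have := free p Wp; have := full p Wp; rewrite /row_free /row_full => /eqP-> /eqP.
(* The same matrix with its shape made square. *)
pose B x : 'M[R[i]]_(frame_rank e) := castmx (EK, erefl) (A x).
have uA x : W x -> B x \in unitmx.
  move=> /full; rewrite -row_full_unit /row_full /B.
  by move: (A x); clear; case: _ / EK => A'; rewrite castmx_id.
have BE x i j : B x i j = A x (cast_ord (esym EK) i) j.
  by rewrite /B castmxE cast_ord_id.
pose c j x := (cf x (s x) *m invmx (B x)) 0 (cast_ord EK j).
exists c.
  move=> j; rewrite /c; under eq_fun do rewrite mxE.
  apply: smooth_cfun_on_sum => // i; apply: smooth_cfun_on_mul => //.
    under eq_fun do rewrite mxE.
    by apply: smooth_cfun_onW (ss e eV i) => x Wx; split=> //; exact: We.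
  apply: smooth_cfun_on_invmx => // a b.
  under eq_fun do rewrite BE mxE.
  by apply: smooth_cfun_onW (sh _ e eV b) => x Wx; split=> //; exact: We.
move=> x Wx.
pose cr : 'rV[R[i]]_K := \row_j c j x.
have -> : \sum_j c j x *: h j x = \sum_j cr 0 j *: h j x.
  by apply: eq_bigr => j _; rewrite mxE.
rewrite [LHS](cfE x) // [RHS](cfE x) // cf_mul; apply: eq_bigr => i _; congr (_ *: _).
have -> : cr *m A x = (cf x (s x) *m invmx (B x)) *m B x.
  apply/rowP => a; rewrite [LHS]mxE [RHS]mxE [RHS](reindex (cast_ord EK)) /=.
    by apply: eq_bigr => b _; rewrite BE cast_ordK [cr 0 b]mxE.
  by exists (cast_ord (esym EK)) => ? _; rewrite ?cast_ordK ?cast_ordKV.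
by rewrite mulmxKV //; exact: uA.
Qed.

End Sections.

(** * Frames adapted to the grading *)

Section IterLinear.
Variables (K : fieldType) (vT : vectType K) (f : 'End(vT)).

Lemma iter_lfunP k (a : K) (u v : vT) :
  iter k f (a *: u + v) = a *: iter k f u + iter k f v.
Proof. by elim: k => //= k ->; rewrite linearP. Qed.

Lemma iter_lfun0 k : iter k f 0 = 0.
Proof. by elim: k => //= k ->; rewrite linear0. Qed.

Lemma iter_lfunD k u v : iter k f (u + v) = iter k f u + iter k f v.
Proof. by have := iter_lfunP k 1 u v; rewrite !scale1r. Qed.

Lemma iter_lfunZ k a u : iter k f (a *: u) = a *: iter k f u.
Proof. by have := iter_lfunP k a u 0; rewrite iter_lfun0 !addr0. Qed.

Lemma iter_lfunB k u v : iter k f (u - v) = iter k f u - iter k f v.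
Proof. by rewrite iter_lfunD -scaleN1r iter_lfunZ scaleN1r. Qed.

Lemma iter_lfun_sum k (I : Type) (r : seq I) (P : pred I) (u : I -> vT) :
  iter k f (\sum_(i <- r | P i) u i) = \sum_(i <- r | P i) iter k f (u i).
Proof. exact: (big_morph _ (iter_lfunD k) (iter_lfun0 k)). Qed.

Lemma iter_lfun_kill j k u : (j <= k)%N -> iter j f u = 0 -> iter k f u = 0.
Proof. by move=> /subnK <- fu; rewrite iterD fu iter_lfun0. Qed.

End IterLinear.

Section Fiber.
Variables (R : realType) (m n : nat) (M : manifold R m).
Variables (V : lefschetz_bundle M n) (x : M).
Local Notation L := (lef_op V x).
Local Notation gr k := (lef_gr V k x).
Implicit Types u v w : V x.

Lemma lef_iter_degree i l u : (l + i.*2 <= n.*2)%N ->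
  u \in gr l -> iter i L u \in gr (l + i.*2)%N.
Proof.
elim: i => [|i IH] li ul; first by rewrite addn0.
rewrite iterS doubleS !addnS; apply: lef_op_degree; first by lia.
by apply: IH => //; lia.
Qed.

Lemma lef_iter_top i l u : (l <= n.*2 < l + i.*2)%N -> u \in gr l ->
  iter i L u = 0.
Proof.
elim: i => [|i IH] li ul; first by lia.
have [lei|gti] := leqP (l + i.*2) n.*2; last by rewrite iterS IH ?linear0 //; lia.
rewrite iterS; apply: (@lef_op_top _ _ _ _ _ (l + i.*2)%N).
  by apply/orP; lia.
exact: lef_iter_degree.
Qed.

Lemma lef_iter_inj j u : (j <= n)%N -> u \in gr (n - j)%N ->
  iter j L u = 0 -> u = 0.
Proof.
move=> jn uj ju; have [_ inj _] := lef_op_iso V x jn.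
apply: inj; rewrite ?inE ?mem0v //=; first by rewrite mem0v.
by rewrite ju iter_lfun0.
Qed.

Lemma lef_iter_surj j w : (j <= n)%N -> w \in gr (n + j)%N ->
  exists2 u, u \in gr (n - j)%N & iter j L u = w.
Proof.
by move=> jn wj; have [_ _ /(_ w wj)[u uj <-]] := lef_op_iso V x jn; exists u.
Qed.

End Fiber.

(** For [k <= 2n], the map [L^(lift_exp n k)] is an isomorphism from the summand
of degree [lift_deg n k <= n] onto [V^k].  It is the identity when [k <= n], by
truncated subtraction. *)
Definition lift_deg (n k : nat) := if (k <= n)%N then k else (n.*2 - k)%N.
Definition lift_exp (n k : nat) := (k - n)%N.

Section Adapted.
Variables (R : realType) (m n : nat) (M : manifold R m).
Variables (V : lefschetz_bundle M n).
Local Notation L := (lef_op V).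
Local Notation gr := (lef_gr V).
Local Notation lift k x := (iter (lift_exp n k) (L x)).
Local Notation ldeg k := (lift_deg n k).
Local Notation idx := 'I_n.*2.+1.

Lemma lift_deg_le k : (k < n.*2.+1)%N -> (ldeg k <= n.*2)%N.
Proof. by rewrite /lift_deg; case: (leqP k n); lia. Qed.

Lemma lift_degree k x (u : V x) : (k <= n.*2)%N ->
  u \in gr (ldeg k) x -> lift k x u \in gr k x.
Proof.
rewrite /lift_deg /lift_exp => kn; case: leqP => nk uk.
  by rewrite (eqP nk).
have E : k = (n.*2 - k + (k - n).*2)%N by lia.
by rewrite [X in gr X]E; apply: lef_iter_degree => //; lia.
Qed.

Lemma lift_inj k x (u : V x) : (k <= n.*2)%N ->
  u \in gr (ldeg k) x -> lift k x u = 0 -> u = 0.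
Proof.
rewrite /lift_deg /lift_exp => kn; case: leqP => nk uk.
  by rewrite (eqP nk).
apply: lef_iter_inj; first by lia.
by have -> : (n - (k - n) = n.*2 - k)%N by lia.
Qed.

Lemma lift_surj k x (w : V x) : (k <= n.*2)%N ->
  w \in gr k x -> exists2 u, u \in gr (ldeg k) x & lift k x u = w.
Proof.
rewrite /lift_deg /lift_exp => kn; case: leqP => nk wk.
  by exists w; rewrite ?(eqP nk).
have [||u uk <-] := @lef_iter_surj _ _ _ _ V x (k - n) w; first by lia.
  by rewrite subnKC // ltnW.
by exists u => //; have <- : (n - (k - n) = n.*2 - k)%N by lia.
Qed.

(** This and [adapted_unique] identify the fibre with the direct sum of the
summands [V^(lift_deg n k)] over [k <= 2n]. *)
Lemma adapted_exists x (v : V x) : exists2 t : idx -> V x,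
  forall k : idx, t k \in gr (ldeg k) x & v = \sum_(k : idx) lift k x (t k).
Proof.
have := memvf v; rewrite -(lef_gr_full V x) => /memv_sumP[w wk ->].
have /choice[t Ht] (k : idx) : exists u, u \in gr (ldeg k) x /\ lift k x u = w k.
  by have [|u uk <-] := lift_surj (k := k) _ (wk k isT); [rewrite -ltnS | exists u].
exists t => [k|]; first by have [] := Ht k.
by apply: eq_bigr => k _; have [_ ->] := Ht k.
Qed.

Lemma adapted_independent x (t : idx -> V x) :
  (forall k : idx, t k \in gr (ldeg k) x) -> \sum_(k : idx) lift k x (t k) = 0 ->
  forall k, t k = 0.
Proof.
move=> tk t0 k; apply: (@lift_inj k) => //; first by rewrite -ltnS.
have /directv_sum_independent dir := lef_gr_direct V x.
apply: (dir (fun i : idx => lift i x (t i))) => // i _.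
by apply: lift_degree => //; rewrite -ltnS.
Qed.

Lemma adapted_unique x (t t' : idx -> V x) :
  (forall k : idx, t k \in gr (ldeg k) x) -> (forall k : idx, t' k \in gr (ldeg k) x) ->
  \sum_(k : idx) lift k x (t k) = \sum_(k : idx) lift k x (t' k) -> t =1 t'.
Proof.
move=> tk t'k tt' k; apply/eqP; rewrite -subr_eq0; apply/eqP.
apply: (@adapted_independent x (fun k : idx => t k - t' k)) => [i|].
  exact: rpredB.
under eq_bigr do rewrite iter_lfunB.
by rewrite sumrB tt' subrr.
Qed.

Lemma smooth_lef_iter W r (s : section V) : open W ->
  smooth_section_on W s -> smooth_section_on W (fun x => iter r (L x) (s x)).
Proof.
move=> Wo ss; elim: r => //= r IH.
exact: (smooth_section_on_endo (@lef_op_smooth _ _ _ _ V) Wo IH).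
Qed.

(** The frame adapted to the grading: for each [k] take a local frame of
[V^(lift_deg n k)] and apply [L^(lift_exp n k)] to it. *)
Lemma adapted_local (p : M) : exists W, [/\ open W, W p &
  forall s : section V, smooth_section s ->
  exists t : idx -> section V,
    [/\ forall k, smooth_section_on W (t k),
        forall (k : idx) x, W x -> t k x \in gr (ldeg k) x &
        forall x, W x -> s x = \sum_(k : idx) lift k x (t k x)]].
Proof.
have [e0 e0V e0p] := bdl_cover V p.
have /choice[e He] (k : idx) :=
  @lef_gr_subbundle _ _ _ _ V _ (lift_deg_le (ltn_ord k)) p.
pose W0 : set M := [set x | frame_dom e0 x /\ forall k, frame_dom (e k) x].
have W0p : nbhs p W0.
  apply: filterI.
    by apply: open_nbhs_nbhs; split=> //; exact: bdl_frame_open.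
  apply: filter_forall => k; apply: open_nbhs_nbhs.
  by have [] := He k.
pose W := interior W0.
have WW0 : W `<=` W0 := @interior_subset _ W0.
have Wo : open W := @open_interior _ W0.
have We0 : W `<=` frame_dom e0 by move=> x /WW0[].
have We k : W `<=` frame_dom (e k) by move=> x /WW0[_].
exists W; split=> // s ss.
(* Pairs of a degree and an index in the frame chosen for that degree. *)
pose I := {k : 'I_n.*2.+1 & 'I_(frame_rank (e k))}.
pose mk (k : idx) (i : 'I_(frame_rank (e k))) : I :=
  Tagged (fun k => 'I_(frame_rank (e k))) i.
pose f (a : I) : section V := fun x => tnth (frame_vec (e (tag a)) x) (tagged a).
have fsm a : smooth_section_on W (f a).
  by have [_ _ _ /(_ (tagged a))] := He (tag a); apply: smooth_section_onW.
pose h (j : 'I_#|{: I}|) : section V :=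
  fun x => lift (tag (enum_val j)) x (f (enum_val j) x).
have sumI x (c : I -> R[i]) : \sum_j c (enum_val j) *: h j x =
    \sum_(k : idx) lift k x (\sum_i c (mk k i) *: f (mk k i) x).
  rewrite -(big_enum_val (fun a : I => c a *: lift (tag a) x (f a x))) /=.
  under [RHS]eq_bigr do rewrite iter_lfun_sum.
  rewrite (sig_big_dep _ _ (fun (k : idx) (i : 'I_(frame_rank (e k))) =>
    lift k x (c (mk k i) *: f (mk k i) x))) /=.
  by apply: eq_bigr => -[k i] _; rewrite iter_lfunZ.
have fgr x k i : W x -> f (mk k i) x \in gr (ldeg (k : 'I__)) x.
  move=> Wx; have [_ _ /(_ x (We k x Wx)) B _] := He k.
  by rewrite -(span_basis B); apply: memv_span; exact: mem_tnth.
have fexp x k (v : V x) : W x -> v \in gr (ldeg (k : 'I__)) x ->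
    v = \sum_i coord (frame_vec (e k) x) i v *: f (mk k i) x.
  move=> Wx vk; have [_ _ /(_ x (We k x Wx)) B _] := He k.
  rewrite {1}(coord_basis B vk); apply: eq_bigr => i _.
  by rewrite /f /= (tnth_nth 0).
have [||||c csm sE] :=
  @smooth_coord_fiberwise_basis _ _ _ V e0 W p _ h s e0V Wo We0 W0p.
- by move=> j; apply: smooth_lef_iter.
- move=> x Wx v; have [t tk ->] := adapted_exists v.
  exists (fun j => let a := enum_val j in
     coord (frame_vec (e (tag a)) x) (tagged a) (t (tag a))).
  rewrite (sumI x (fun a => coord (frame_vec (e (tag a)) x) (tagged a) (t (tag a)))).
  by apply: eq_bigr => k _; rewrite {1}(fexp x k _ Wx (tk k)).
- move=> x Wx c c0 j.
  pose c' a := c (enum_rank a).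
  have cE i : c i = c' (enum_val i) by rewrite /c' enum_valK.
  have {c0} : \sum_j c' (enum_val j) *: h j x = 0.
    by rewrite -[RHS]c0; apply: eq_bigr => i _; rewrite -cE.
  rewrite sumI => /adapted_independent c0.
  rewrite cE; case: (enum_val j) => k i.
  have {}c0 := c0 (fun k => rpred_sum _ _) k.
  have [_ _ /(_ x (We k x Wx)) /basis_free/freeP B _] := He k.
  apply: (B (fun i => c' (mk k i))).
  rewrite -[RHS]c0; last by move=> k' i' _; apply: rpredZ; exact: fgr.
  by apply: eq_bigr => i' _; rewrite /f /= (tnth_nth 0).
- exact: smooth_section_onW ss.
exists (fun k x => \sum_i c (enum_rank (mk k i)) x *: f (mk k i) x).
split=> [k|k x Wx|x Wx].
- by apply: smooth_section_on_sum => // i _; apply: smooth_section_on_scale.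
- by apply: rpred_sum => i _; apply: rpredZ; exact: fgr.
rewrite sE // -(sumI x (fun a => c (enum_rank a) x)).
by apply: eq_bigr => j _; rewrite enum_valK.
Qed.

(** The components exist pointwise; being unique, they coincide near each point
with the smooth ones provided by a local adapted frame. *)
Lemma adapted_decomposition (s : section V) : smooth_section s ->
  exists t : idx -> section V,
    [/\ forall k, smooth_section (t k),
        forall (k : idx) x, t k x \in gr (ldeg k) x &
        forall x, s x = \sum_(k : idx) lift k x (t k x)].
Proof.
move=> ss; pose t0 x := cid2 (adapted_exists (s x)).
pose t k : section V := fun x => sval (t0 x) k.
have tk k x : t k x \in gr (ldeg k) x by rewrite /t; case: (t0 x).
have tE x : s x = \sum_(k : idx) lift k x (t k x) by rewrite /t; case: (t0 x).
exists t; split=> // k.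
apply: smooth_section_on_local => p _.
have [W [Wo Wp /(_ s ss)[t' [t'sm t'k t'E]]]] := adapted_local p.
exists W; split=> //; rewrite setIT.
apply: smooth_section_on_eq (t'sm k) => // x Wx.
apply: (@adapted_unique x (fun k => t' k x) (fun k => t k x)) => //.
  by move=> i; exact: t'k.
by rewrite -tE -t'E.
Qed.

End Adapted.

(** * Primitive vectors and the star operator *)

Section DividedPowers.
Variables (R : realType) (m n : nat) (M : manifold R m).
Variables (V : lefschetz_bundle M n) (x : M).
Local Notation L := (lef_op V x).
Implicit Types (u v w : V x) (r : int).

Lemma divpow0 r : lef_divpow r (0 : V x) = 0.
Proof. by case: r => //= r; rewrite iter_lfun0 scaler0. Qed.

Lemma divpowD r u v : lef_divpow r (u + v) = lef_divpow r u + lef_divpow r v.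
Proof. by case: r => /= r; rewrite ?addr0 // iter_lfunD scalerDr. Qed.

Lemma divpowZ r a u : lef_divpow r (a *: u) = a *: lef_divpow r u.
Proof.
by case: r => /= r; rewrite ?scaler0 // iter_lfunZ !scalerA mulrC.
Qed.

Lemma lef_divpow_succ r u : L (lef_divpow r u) = (r + 1)%:~R *: lef_divpow (r + 1) u.
Proof.
case: r => [r|[|r]].
- have -> : Posz r + 1 = Posz r.+1 by lia.
  rewrite /= linearZ /= scalerA; congr (_ *: _).
  by rewrite factS natrM invfM mulrA mulfV ?mul1r // pnatr_eq0.
- by rewrite /= linear0 scale0r.
have -> : Negz r.+1 + 1 = Negz r by lia.
by rewrite /= linear0 scaler0.
Qed.

Lemma divpow_lef r u : lef_divpow r (L u) = L (lef_divpow r u).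
Proof.
by case: r => /= r; rewrite ?linear0 // linearZ /= -iterS -iterSr.
Qed.

Lemma iter_divpow (r : nat) u : iter r L u = lef_divpow r%:Z (r`!%:R *: u).
Proof.
by rewrite /= iter_lfunZ scalerA mulVf ?scale1r // pnatr_eq0 -lt0n fact_gt0.
Qed.

Lemma primitive0 : primitive 0 (0 : V x).
Proof. by split=> //; rewrite ?mem0v // iter_lfun0. Qed.

Lemma primitiveZ k a u : primitive k u -> primitive k (a *: u).
Proof. by case=> uk kn u0; split=> //; rewrite ?memvZ // iter_lfunZ u0 scaler0. Qed.

End DividedPowers.

Section Lower.
Variables (R : realType) (m n : nat) (M : manifold R m).
Variables (V : lefschetz_bundle M n).
Local Notation L := (lef_op V).
Local Notation gr := (lef_gr V).

(** Where the non-primitive part [w'] of [w0 + L w'] lies when the sum has degree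
[k].  The case distinction avoids [V^(k-2)], which truncated subtraction would
turn into [V^0] for [k < 2]. *)
Definition lower k x : {vspace V x} := if k is k'.+2 then gr k' x else 0%VS.

(** The exponent is [n - (k - 2)], the power of [L] that is an isomorphism on
degree [k - 2]. *)
Lemma lower_inj k x (w : V x) : (k <= n)%N -> w \in lower k x ->
  iter (n - k).+2 (L x) w = 0 -> w = 0.
Proof.
case: k => [|[|k]] kn; rewrite ?memv0; [by move/eqP|by move/eqP|] => wk.
apply: lef_iter_inj; first by lia.
by have -> : (n - (n - k.+2).+2 = k)%N by lia.
Qed.

Lemma lower_primitive k x (w : V x) : (k <= n)%N -> w \in lower k x ->
  iter (n - k).+3 (L x) w = 0 -> w = 0 \/ exists2 j, (k = j.+2)%N & primitive j w.
Proof.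
case: k => [|[|k]] kn; rewrite ?memv0; [by move/eqP; left|by move/eqP; left|].
move=> wk w0; right; exists k => //; split=> //; first by lia.
by have -> : ((n - k).+1 = (n - k.+2).+3)%N by lia.
Qed.

Lemma primitive_low k x (w : V x) : (k <= n)%N -> (k < 2)%N -> w \in gr k x ->
  primitive k w.
Proof.
move=> kn k2 wk; split=> //; apply: lef_iter_top wk; lia.
Qed.

(** The only possible choice of the part of [w] in the image of [L] is the one
that matches [w] under [L^(n-k-1)], where primitive vectors of degree [k + 2]
vanish. *)
Lemma primitive_remainder k x (w w' : V x) : (k.+2 <= n)%N -> w \in gr k.+2 x ->
  w' \in gr k x -> iter (n - k) (L x) w' = iter (n - k.+2).+1 (L x) w ->
  primitive k.+2 (w - L x w').
Proof.
move=> kn wk wk' E; split=> //.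
  by apply: rpredB => //; apply: lef_op_degree => //; lia.
rewrite iter_lfunB -E -iterSr.
by have -> : ((n - k.+2).+2 = n - k)%N; [lia | rewrite subrr].
Qed.

Lemma lefschetz_split k x (w : V x) : (k <= n)%N -> w \in gr k x ->
  exists w0 w', [/\ primitive k w0, w' \in lower k x & w = w0 + L x w'].
Proof.
case: k => [|[|k]] kn wk; try (exists w, 0; split;
  [exact: primitive_low|exact: mem0v|by rewrite linear0 addr0]).
have [||w' w'k E] := @lift_surj _ _ _ _ V (n.*2 - k)%N x
  (iter (n - k.+2).+1 (L x) w); first by lia.
  have -> : (n.*2 - k = k.+2 + (n - k.+2).+1.*2)%N by lia.
  by apply: lef_iter_degree => //; lia.
have gk : w' \in gr k x.
  move: w'k; rewrite /lift_deg; case: leqP => ?; last first.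
    by have -> : (n.*2 - (n.*2 - k) = k)%N by lia.
  by lia.
exists (w - L x w'), w'; split=> //; last by rewrite subrK.
apply: primitive_remainder => //; rewrite -E /lift_exp.
by have -> : (n.*2 - k - n = n - k)%N by lia.
Qed.

(** The Lefschetz decomposition of a fibre as an induction principle: repeated
splitting in degrees at most [n], and the isomorphisms
[L^j] above the middle degree. *)
Lemma lefschetz_ind x (Q : V x -> Prop) :
  (forall u v, Q u -> Q v -> Q (u + v)) ->
  (forall k (u : V x) (r : nat), primitive k u -> Q (lef_divpow r%:Z u)) ->
  forall v, Q v.
Proof.
move=> QD Qp.
have Q0 : Q 0 by have := Qp 0%N 0 0%N (primitive0 V x); rewrite divpow0.
have Qdeg k r (w : V x) : (k <= n)%N -> w \in gr k x -> Q (iter r (L x) w).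
  elim/ltn_ind: k r w => k IH r w kn /(lefschetz_split kn)[w0 [w' [w0p w'k ->]]].
  rewrite iter_lfunD; apply: QD.
    by rewrite iter_divpow; apply: Qp (primitiveZ _ w0p).
  rewrite -iterSr; case: k IH kn w'k {w0p} => [|[|k]] IH kn.
  - by rewrite memv0 => /eqP->; rewrite iter_lfun0.
  - by rewrite memv0 => /eqP->; rewrite iter_lfun0.
  by apply: IH; lia.
move=> v; have [t tk ->] := adapted_exists v.
apply: (big_ind Q) => // k _; apply: Qdeg (tk k).
by rewrite /lift_deg; case: (leqP k n) => //; have := ltn_ord k; lia.
Qed.

(** Inverting [L^j] between complementary degrees preserves smoothness. *)
Lemma smooth_lift K (s : section V) : (K <= n.*2)%N -> smooth_section s ->
  (forall x, s x \in gr K x) ->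
  exists t : section V, [/\ smooth_section t,
    forall x, t x \in gr (lift_deg n K) x &
    forall x, iter (lift_exp n K) (L x) (t x) = s x].
Proof.
move=> Kn ss sK; have [t [tsm tk tE]] := adapted_decomposition ss.
pose K' : 'I_n.*2.+1 := Ordinal (Kn : (K < n.*2.+1)%N).
exists (t K'); split=> [||x]; [exact: tsm|exact: (tk K')|].
have [u uK uE] := lift_surj Kn (sK x).
pose t' (k : 'I_n.*2.+1) := if k == K' then u else 0.
have -> : t K' x = t' K'; last by rewrite /t' eqxx.
apply: (@adapted_unique _ _ _ _ V x (fun k => t k x) t') => [k|k|].
- exact: tk.
- by rewrite /t'; case: eqP => [->|_] //; exact: mem0v.
rewrite -tE (bigD1 K') //= {1}/t' eqxx uE big1 ?addr0 // => k /negPf kK.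
by rewrite /t' kK iter_lfun0.
Qed.

Lemma smooth_lefschetz_split k (s : section V) : (k <= n)%N ->
  smooth_section s -> (forall x, s x \in gr k x) ->
  exists s0 s' : section V, [/\ smooth_section s0, smooth_section s',
    forall x, primitive k (s0 x), forall x, s' x \in lower k x &
    forall x, s x = s0 x + L x (s' x)].
Proof.
case: k => [|[|k]] kn ss sk; try (exists s, (fun x => 0); split=> // [|x|x|x];
  [exact: smooth_section_on_0|exact: primitive_low|exact: mem0v|
   by rewrite linear0 addr0]).
have [||x|t [tsm tk tE]] := @smooth_lift (n.*2 - k)%N
  (fun x => iter (n - k.+2).+1 (L x) (s x)).
- by lia.
- by apply: smooth_lef_iter => //; exact: openT.
- have -> : (n.*2 - k = k.+2 + (n - k.+2).+1.*2)%N by lia.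
  by apply: lef_iter_degree => //; lia.
have gk x : t x \in gr k x.
  move: (tk x); rewrite /lift_deg; case: leqP => ?; last first.
    by have -> : (n.*2 - (n.*2 - k) = k)%N by lia.
  by lia.
exists (fun x => s x - L x (t x)), t; split=> // [|x|x].
- apply: (smooth_section_on_eq openT) (smooth_section_on_add openT ss
    (smooth_section_on_scale openT (smooth_cfun_on_cst _ (-1))
      (smooth_lef_iter 1 openT tsm))) => x _.
  by rewrite scaleN1r.
- apply: primitive_remainder => //; rewrite -tE /lift_exp.
  by have -> : (n.*2 - k - n = n - k)%N by lia.
by rewrite subrK.
Qed.

Lemma smooth_divpow r (u : section V) : smooth_section u ->
  smooth_section (fun x => lef_divpow r (u x)).
Proof.
move=> su; case: r => r /=; last exact: smooth_section_on_0.
apply: (smooth_section_on_scale openT) (smooth_lef_iter r openT su).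
exact: smooth_cfun_on_cst.
Qed.

(** The analogue of [lefschetz_ind] for sections: every component met in the
decomposition is smooth. *)
Lemma smooth_lefschetz_ind (Q : section V -> Prop) :
  (forall s t, Q s -> Q t -> Q (fun x => s x + t x)) ->
  (forall k (u : section V) (r : nat), smooth_section u ->
     (forall x, primitive k (u x)) -> Q (fun x => lef_divpow r%:Z (u x))) ->
  forall s, smooth_section s -> Q s.
Proof.
move=> QD Qp.
have ext (s t : section V) : (forall x, s x = t x) -> Q s -> Q t.
  by move=> st; have -> : s = t by exact: functional_extensionality_dep.
have Q0 : Q (fun x => 0).
  apply: (@ext (fun x => lef_divpow 0%N%:Z (0 : V x))) => [x|]; first exact: divpow0.
  apply: (Qp 0%N (fun x => 0) 0%N) => [|x]; last exact: primitive0.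
  exact: smooth_section_on_0.
have Qdeg k r (s : section V) : (k <= n)%N -> smooth_section s ->
    (forall x, s x \in gr k x) -> Q (fun x => iter r (L x) (s x)).
  elim/ltn_ind: k r s => k IH r s kn ss sk.
  have [s0 [s' [s0sm s'sm s0p s'k sE]]] := smooth_lefschetz_split kn ss sk.
  apply: (@ext (fun x => iter r (L x) (s0 x) + iter r.+1 (L x) (s' x))) => [x|].
    by rewrite sE iter_lfunD -iterSr.
  apply: QD.
    apply: (@ext (fun x => lef_divpow r%:Z (r`!%:R *: s0 x))) => [x|].
      by rewrite iter_divpow.
    apply: (Qp k (fun x => r`!%:R *: s0 x)) => [|x]; last exact: primitiveZ.
    apply: (smooth_section_on_scale openT) s0sm.
    exact: smooth_cfun_on_cst.
  case: k IH kn s'k {sk s0p} => [|[|k]] IH kn s'k.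
  - apply: ext Q0 => x; have /eqP-> : s' x == 0 by rewrite -memv0 s'k.
    by rewrite iter_lfun0.
  - apply: ext Q0 => x; have /eqP-> : s' x == 0 by rewrite -memv0 s'k.
    by rewrite iter_lfun0.
  by apply: (IH k) => //; lia.
move=> s /adapted_decomposition[t [tsm tk tE]].
apply: (ext _ _ (fun x => esym (tE x))).
elim: (index_enum _) => [|k r IH].
  by apply: ext Q0 => x; rewrite big_nil.
apply: (@ext (fun x => iter (lift_exp n k) (L x) (t k x)
   + \sum_(k <- r) iter (lift_exp n k) (L x) (t k x))) => [x|].
  by rewrite big_cons.
apply: QD => //; apply: (Qdeg (lift_deg n k)) => //.
by rewrite /lift_deg; case: (leqP k n) => //; have := ltn_ord k; lia.
Qed.

End Lower.

Section Star.
Variables (R : realType) (m n : nat) (M : manifold R m).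
Variables (V : lefschetz_bundle M n) (star : endo V).
Hypothesis starP : lefschetz_star star.
Local Notation L := (lef_op V).

Definition star_sign k : R[i] := (-1) ^+ (\sum_(1 <= i < k.+1) i)%N.

Lemma star_sign_succ2 k : star_sign k.+2 = - star_sign k.
Proof.
rewrite /star_sign 2?big_nat_recr //= -addnA exprD.
by rewrite addnS addnn [X in _ * X]exprS -mul2n exprM sqrrN !expr1n mulr1 mulrN1.
Qed.

Lemma star_sign_sqr k : star_sign k * star_sign k = 1.
Proof. by rewrite -expr2 sqrr_sign. Qed.

(** How the star operator acts on the string generated by a primitive vector [w]
of degree [n - N], with [e] its sign.  The zero vector satisfies this for all
[N] and [e], so that components in degrees where there is no primitive vector
need no separate treatment. *)
Definition star_flips (N : int) (e : R[i]) x (w : V x) :=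
  forall r : int, star x (lef_divpow r w) = e *: lef_divpow (N - r) w.

Lemma star_flips0 N e x : star_flips N e (0 : V x).
Proof. by move=> r; rewrite !divpow0 linear0 scaler0. Qed.

Lemma star_flips_primitive k x (u : V x) : primitive k u ->
  star_flips (n%:Z - k%:Z) (star_sign k) u.
Proof. by move=> up r; rewrite (starP up) addrAC. Qed.

Lemma star_flipsK N e x (w : V x) r : e * e = 1 -> star_flips N e w ->
  star x (star x (lef_divpow r w)) = lef_divpow r w.
Proof.
by move=> e1 we; rewrite we linearZ /= we scalerA e1 scale1r subKr.
Qed.

Lemma starK x (v : V x) : star x (star x v) = v.
Proof.
move: v; apply: lefschetz_ind => [u v Hu Hv|k u r up].
  by rewrite !linearD /= Hu Hv.
exact: star_flipsK (star_sign_sqr k) (star_flips_primitive up).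
Qed.

Lemma endo_inv_star x (v : V x) : endo_inv star x v = star x v.
Proof.
have inj : lker (star x) == 0%VS.
  by apply/lker0P => a b E; rewrite -[a]starK E starK.
by rewrite -{1}[v]starK /endo_inv lker0_lfunK.
Qed.

Lemma dual_lefschetzE x (v : V x) :
  dual_lefschetz star x v = star x (L x (star x v)).
Proof. by rewrite /dual_lefschetz /endo_mul !comp_lfunE endo_inv_star. Qed.

(** The lowering operator of the [sl_2]-action. *)
Lemma dual_lefschetz_divpow N e x (w : V x) r : e * e = 1 -> star_flips N e w ->
  dual_lefschetz star x (lef_divpow r w) = (N - r + 1)%:~R *: lef_divpow (r - 1) w.
Proof.
move=> e1 we; rewrite dual_lefschetzE we !linearZ /= lef_divpow_succ linearZ /=.
rewrite we !scalerA [e * _]mulrC -mulrA e1 mulr1; congr (_ *: lef_divpow _ w).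
by rewrite opprD opprB addrA addrCA subrr addr0.
Qed.

Lemma smooth_star (s : section V) : smooth_section s ->
  smooth_section (fun x => star x (s x)).
Proof.
move: s; apply: smooth_lefschetz_ind => [s t ss st|k u r su up].
  apply: (smooth_section_on_eq openT) (smooth_section_on_add openT ss st) => x _.
  by rewrite linearD.
apply: (smooth_section_on_eq openT) (smooth_section_on_scale openT
  (smooth_cfun_on_cst _ (star_sign k))
  (smooth_divpow (n%:Z - k%:Z - r%:Z) su)) => x _.
by rewrite (star_flips_primitive (up x)).
Qed.

Lemma smooth_dual_lefschetz (s : section V) : smooth_section s ->
  smooth_section (fun x => dual_lefschetz star x (s x)).
Proof.
move=> /smooth_star/(smooth_lef_iter 1 openT)/smooth_star.
by apply: (smooth_section_on_eq openT) => x _; rewrite dual_lefschetzE.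
Qed.

End Star.

(** * The connection on Lefschetz strings *)

Section ThetaSplit.
Variables (R : realType) (m n : nat) (M : manifold R m).
Variables (V : lefschetz_bundle M n) (star : endo V).
Hypothesis starP : lefschetz_star star.
Variables (x : M) (k : nat).
Hypothesis kn : (k <= n)%N.
Local Notation L := (lef_op V x).
Local Notation gr k := (lef_gr V k x).
Local Notation N := (n - k)%N.
Local Notation e := (star_sign R k).
Implicit Types u v w b : V x.

(** Where [theta u] lies for [u] of degree [k].  The summands of degree above
[2n] are arbitrary, hence the case distinction. *)
Definition upper : {vspace V x} := if (k.+2 <= n.*2)%N then gr k.+2 else 0%VS.

(** For [k + 2 <= n] this is one step of the Lefschetz decomposition.  Otherwise
[k] is [n - 1] or [n], there are no primitive vectors in degree [k + 2], and
[L] maps degree [k] onto degree [k + 2]. *)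
Lemma upper_split b : b \in upper -> iter N.+1 L b = 0 ->
  exists b0 b1, [/\ b = b0 + L b1, star_flips star (N%:Z - 2) (- e) b0,
    iter N L b0 = 0, b1 \in gr k & iter N.+2 L b1 = 0].
Proof.
rewrite /upper => bk b0.
have [k2|k2] := leqP k.+2 n.
  move: bk; rewrite ifT; last by lia.
  move=> /(lefschetz_split k2)[w0 [w' [w0p w'k bE]]].
  have w00 : iter N L w0 = 0 by case: w0p => _ _; apply: iter_lfun_kill; lia.
  exists w0, w'; split=> //.
    rewrite -star_sign_succ2.
    have -> : N%:Z - 2 = n%:Z - k.+2%:Z :> int by lia.
    exact: star_flips_primitive.
  rewrite -b0 bE iter_lfunD -iterSr.
  by rewrite (iter_lfun_kill _ w00) ?add0r //; lia.
have [b1 b1k bE] : exists2 b1, b1 \in gr k & L b1 = b.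
  move: bk; case: ifP => [k2n bk|_]; last first.
    by rewrite memv0 => /eqP->; exists 0; rewrite ?mem0v ?linear0.
  have [kn1|kn1] : k.+1 = n \/ k = n by lia.
    have [||u uk <-] := @lef_iter_surj _ _ _ _ V x 1 b.
    - by lia.
    - by have -> : (n + 1 = k.+2)%N by lia.
    by exists u => //; have <- : (n - 1 = k)%N by lia.
  have [||u uk <-] := @lef_iter_surj _ _ _ _ V x 2 b.
  - by lia.
  - by have -> : (n + 2 = k.+2)%N by lia.
  exists (L u) => //.
  have -> : k = (n - 2).+2 by lia.
  by apply: lef_op_degree => //; lia.
exists 0, b1; split=> //.
- by rewrite add0r.
- exact: star_flips0.
- exact: iter_lfun0.
by rewrite iterSr bE.
Qed.

(** The two hypotheses on [iter] come from differentiating [L^(N+1) u = 0].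
[L^(N+3)] annihilates the part [b2] of degree [k - 2] of [b], which makes it
primitive; then [a' + (N+1) b2], where [L a'] is the non-primitive part of [a],
is in the kernel of the injective map [L^(N+2)]. *)
Lemma variation_split a b : a \in gr k -> b \in upper ->
  iter N.+1 L b = 0 -> iter N.+1 L a + N.+1%:R *: iter N L b = 0 ->
  exists a0 b0 b1 b2,
    [/\ a = a0 - N.+1%:R *: L b2, b = b0 + L (b1 + L b2),
        star_flips star N%:Z e a0 /\ star_flips star N%:Z e b1,
        star_flips star (N%:Z - 2) (- e) b0 &
        star_flips star (N%:Z + 2) (- e) b2].
Proof.
move=> ak bk bN abN.
have [b0 [c [bE b0f b0N ck cN]]] := upper_split bk bN.
have [b1 [b2 [b1p b2k cE]]] := lefschetz_split kn ck.
have [a0 [a' [a0p a'k aE]]] := lefschetz_split kn ak.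
have b1N : iter N.+1 L b1 = 0 by case: b1p.
have a0N : iter N.+1 L a0 = 0 by case: a0p.
have b2N : iter N.+3 L b2 = 0.
  rewrite -cN cE iter_lfunD -iterSr (iter_lfun_kill _ b1N) ?add0r //.
have a'E : a' = - N.+1%:R *: b2.
  apply/eqP; rewrite scaleNr -addr_eq0; apply/eqP.
  apply: (lower_inj kn); first by apply: rpredD => //; apply: rpredZ.
  rewrite iter_lfunD iter_lfunZ -abN aE bE cE.
  rewrite !iter_lfunD a0N b0N !add0r -!iterSr.
  by rewrite iter_lfunD -!iterSr b1N add0r.
exists a0, b0, b1, b2; split=> //.
- by rewrite aE a'E scaleNr linearN linearZ.
- by rewrite bE cE.
- have -> : N%:Z = n%:Z - k%:Z :> int by lia.
  by split; exact: star_flips_primitive.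
have [->|[j kj b2p]] := lower_primitive kn b2k b2N; first exact: star_flips0.
have -> : N%:Z + 2 = n%:Z - j%:Z :> int by lia.
rewrite kj star_sign_succ2 opprK; exact: star_flips_primitive.
Qed.

End ThetaSplit.

Section Connection.
Variables (R : realType) (m n : nat) (M : manifold R m).
Variables (V : lefschetz_bundle M n) (star : endo V) (D : operator V).
Hypothesis starP : lefschetz_star star.
Hypothesis Dconn : connection D.
Hypothesis Ddeg : degree_preserving D.
Let theta := brk_op_endo D (lef_op V).
Arguments D : clear implicits.
Arguments theta : clear implicits.
Hypothesis Ltheta : op_eq (brk_endo_op (lef_op V) theta) (@op_zero R m M V).
Local Notation L := (lef_op V).
Implicit Types s t : section V.

Lemma section_ext (s t : section V) : (forall x, s x = t x) -> s = t.
Proof. exact: functional_extensionality_dep. Qed.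

Lemma connectionP (a : R[i]) s t (x : M) (v : tangent x) :
  smooth_section s -> smooth_section t ->
  D (fun y => a *: s y + t y) x v = a *: D s x v + D t x v.
Proof. by case: Dconn => _ + _ ss st; apply. Qed.

Lemma connection0 (x : M) (v : tangent x) : D (fun y => 0) x v = 0.
Proof.
have s0 := @smooth_section_on_0 R m M V setT.
have := connectionP 1 v s0 s0.
have -> : (fun y => 1 *: (0 : V y) + 0) = (fun y => 0) :> section V.
  by apply: section_ext => y; rewrite scaler0 addr0.
by rewrite scale1r => /eqP; rewrite -subr_eq0 opprD addNKr oppr_eq0 => /eqP.
Qed.

Lemma connectionD s t (x : M) (v : tangent x) :
  smooth_section s -> smooth_section t ->
  D (fun y => s y + t y) x v = D s x v + D t x v.
Proof.
move=> ss st; rewrite -[D s x v]scale1r -connectionP //; congr (D _ x v).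
by apply: section_ext => y; rewrite scale1r.
Qed.

Lemma connectionZ (a : R[i]) s (x : M) (v : tangent x) : smooth_section s ->
  D (fun y => a *: s y) x v = a *: D s x v.
Proof.
move=> ss; rewrite -[RHS]addr0 -(connection0 v) -connectionP //; last first.
  exact: smooth_section_on_0.
by congr (D _ x v); apply: section_ext => y; rewrite addr0.
Qed.

Lemma smooth_iter r s : smooth_section s ->
  smooth_section (fun x => iter r (L x) (s x)).
Proof. exact: (smooth_lef_iter r openT). Qed.

Lemma smooth_lef s : smooth_section s -> smooth_section (fun x => L x (s x)).
Proof. exact: (smooth_iter 1). Qed.

Lemma thetaE s (x : M) (v : tangent x) :
  theta s x v = D (fun y => L y (s y)) x v - L x (D s x v).
Proof. by []. Qed.

Lemma theta_lef s (x : M) (v : tangent x) : smooth_section s ->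
  theta (fun y => L y (s y)) x v = L x (theta s x v).
Proof. by move=> ss; apply/esym/eqP; rewrite -subr_eq0; apply/eqP; exact: Ltheta. Qed.

Lemma thetaD s t (x : M) (v : tangent x) : smooth_section s -> smooth_section t ->
  theta (fun y => s y + t y) x v = theta s x v + theta t x v.
Proof.
move=> ss st; rewrite !thetaE connectionD // linearD opprD addrACA.
congr (_ + _); rewrite -connectionD; try exact: smooth_lef.
by congr (D _ x v); apply: section_ext => y; rewrite linearD.
Qed.

Lemma thetaZ (a : R[i]) s (x : M) (v : tangent x) : smooth_section s ->
  theta (fun y => a *: s y) x v = a *: theta s x v.
Proof.
move=> ss; rewrite !thetaE connectionZ // linearZ /= scalerBr.
congr (_ - _); rewrite -connectionZ; try exact: smooth_lef.
by congr (D _ x v); apply: section_ext => y; rewrite linearZ.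
Qed.

Lemma theta_iter r s (x : M) (v : tangent x) : smooth_section s ->
  theta (fun y => iter r (L y) (s y)) x v = iter r (L x) (theta s x v).
Proof.
move=> ss; elim: r => //= r IH; rewrite theta_lef ?IH //.
exact: smooth_iter.
Qed.

(** Leibniz rule; the [r + 1] terms are equal because [theta] commutes with
[L]. *)
Lemma connection_iter r s (x : M) (v : tangent x) : smooth_section s ->
  D (fun y => iter r.+1 (L y) (s y)) x v =
  iter r.+1 (L x) (D s x v) + r.+1%:R *: iter r (L x) (theta s x v).
Proof.
move=> ss.
have step j : D (fun y => iter j.+1 (L y) (s y)) x v =
    L x (D (fun y => iter j (L y) (s y)) x v) + iter j (L x) (theta s x v).
  by rewrite -theta_iter // thetaE addrC subrK.
elim: r => [|r IH]; first by rewrite step scale1r.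
rewrite step IH linearD linearZ /= -addrA; congr (_ + _).
by rewrite -[r.+2%:R]natr1 scalerDl scale1r.
Qed.

Lemma theta_divpow r s (x : M) (v : tangent x) : smooth_section s ->
  theta (fun y => lef_divpow r (s y)) x v = lef_divpow r (theta s x v).
Proof.
move=> ss; case: r => r /=.
  by rewrite thetaZ ?theta_iter //; exact: smooth_iter.
have s0 : smooth_section (fun y => 0 : V y) by exact: smooth_section_on_0.
rewrite thetaE connection0 linear0 subr0.
have -> : (fun y => L y 0) = (fun y => 0) :> section V.
  by apply: section_ext => y; rewrite linear0.
exact: connection0.
Qed.

Lemma connection_divpow r s (x : M) (v : tangent x) : smooth_section s ->
  D (fun y => lef_divpow r (s y)) x v =
  lef_divpow r (D s x v) + lef_divpow (r - 1) (theta s x v).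
Proof.
move=> ss; case: r => [[|r]|r].
- rewrite /= addr0 -connectionZ //.
- have -> : Posz r.+1 - 1 = Posz r by lia.
  rewrite /lef_divpow connectionZ; last exact: smooth_iter.
  rewrite connection_iter // scalerDr scalerA; congr (_ + _ *: _).
  by rewrite factS natrM invfM mulrC mulrA mulfV ?mul1r // pnatr_eq0.
have -> : Negz r - 1 = Negz r.+1 by lia.
by rewrite /= addr0 connection0.
Qed.

(** When [k + 2 > 2n], both [L u] and [L (D u)] vanish. *)
Lemma theta_upper k u (x : M) (v : tangent x) : (k <= n)%N -> smooth_section u ->
  (forall y, u y \in lef_gr V k y) -> theta u x v \in upper V x k.
Proof.
move=> kn su uk; rewrite /upper thetaE; case: ifPn => k2.
  apply: rpredB.
    by apply: Ddeg => //; [exact: smooth_lef | move=> y; exact: lef_op_degree].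
  by apply: lef_op_degree => //; apply: Ddeg => //; lia.
have top y (w : V y) : w \in lef_gr V k y -> L y w = 0.
  by move=> wk; apply: (@lef_iter_top _ _ _ _ V y 1 k w) => //; lia.
rewrite [L x _]top ?subr0; last by apply: Ddeg => //; lia.
have -> : (fun y => L y (u y)) = (fun y => 0) :> section V.
  by apply: section_ext => y; rewrite top.
by rewrite connection0 mem0v.
Qed.

Lemma theta_primitive_split k u (x : M) (v : tangent x) : smooth_section u ->
  (forall y, primitive k (u y)) ->
  exists a0 b0 b1 b2,
    [/\ D u x v = a0 - (n - k).+1%:R *: L x b2,
        theta u x v = b0 + L x (b1 + L x b2),
        star_flips star (n - k)%:Z (star_sign R k) a0 /\
        star_flips star (n - k)%:Z (star_sign R k) b1,
        star_flips star ((n - k)%:Z - 2) (- star_sign R k) b0 &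
        star_flips star ((n - k)%:Z + 2) (- star_sign R k) b2].
Proof.
move=> su up.
have kn : (k <= n)%N by case: (up x).
have uk y : u y \in lef_gr V k y by case: (up y).
have uN y : iter (n - k).+1 (L y) (u y) = 0 by case: (up y).
have uE : (fun y => iter (n - k).+1 (L y) (u y)) = (fun y => 0) :> section V.
  exact: section_ext.
apply: variation_split => //.
- by apply: Ddeg => //; lia.
- exact: theta_upper.
- rewrite -theta_iter // uE thetaE connection0 linear0 subr0.
  have -> : (fun y => L y 0) = (fun y => 0) :> section V.
    by apply: section_ext => y; rewrite linear0.
  exact: connection0.
by rewrite -connection_iter // uE connection0.
Qed.

(** Both sides are expressed through [L_r a0], [L_(r-1) b0], [L_r b1] and
[L_(r+1) b2].  The coefficients on the left are [1], [-1], [N - r] and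
[(N-r+1)(r+1)]. *)
Lemma conjugation_divpow k u r (x : M) (v : tangent x) : smooth_section u ->
  (forall y, primitive k (u y)) ->
  let s := fun y => lef_divpow r (u y) in
  star x (D (fun y => star y (s y)) x v) =
  D s x v + (dual_lefschetz star x (theta s x v)
             - theta (fun y => dual_lefschetz star y (s y)) x v).
Proof.
move=> su up s.
have [a0 [b0 [b1 [b2 [DE tE [a0f b1f] b0f b2f]]]]] := theta_primitive_split v su up.
set N := (n - k)%N in DE a0f b1f b0f b2f; set e := star_sign R k in a0f b1f b0f b2f.
have kn : (k <= n)%N by case: (up x).
have e1 : e * e = 1 := star_sign_sqr R k.
have eN1 : (- e) * (- e) = 1 by rewrite mulrNN.
have uf y : star_flips star N%:Z e (u y).
  have -> : N%:Z = n%:Z - k%:Z :> int by rewrite /N; lia.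
  exact: star_flips_primitive.
pose comb (q : int) (a b c d : R[i]) := a *: lef_divpow q a0 +
  b *: lef_divpow (q - 1) b0 + c *: lef_divpow q b1 + d *: lef_divpow (q + 1) b2.
have thE q : lef_divpow q (theta u x v) = lef_divpow q b0 +
    (q + 1)%:~R *: lef_divpow (q + 1) b1 +
    ((q + 1) * (q + 1 + 1))%:~R *: lef_divpow (q + 1 + 1) b2.
  rewrite tE linearD !divpowD !divpow_lef !lef_divpow_succ linearZ /= lef_divpow_succ.
  by rewrite scalerA -intrM !addrA.
have DsE q : D (fun y => lef_divpow q (u y)) x v =
    comb q 1 1 q%:~R ((q + 1) * (q - N%:Z - 1))%:~R.
  rewrite connection_divpow // thE DE divpowD -scaleNr divpowZ divpow_lef.
  rewrite lef_divpow_succ subrK scalerA /comb !scale1r -!addrA; congr (_ + _).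
  rewrite addrCA; congr (_ + _); rewrite addrCA; congr (_ + _).
  rewrite -scalerDl; congr (_ *: _).
  rewrite -natr1 !rmorphM !rmorphD !rmorphN /= -pmulrn; ring.
have thsE q : theta (fun y => lef_divpow q (u y)) x v = lef_divpow q (theta u x v).
  exact: theta_divpow.
have LamE q (y : M) : dual_lefschetz star y (lef_divpow q (u y)) =
    (N%:Z - q + 1)%:~R *: lef_divpow (q - 1) (u y).
  exact: dual_lefschetz_divpow e1 (uf y).
have lhs : star x (D (fun y => star y (s y)) x v) =
  comb r 1 (-1) (N%:Z - r)%:~R ((N%:Z - r + 1) * (r + 1))%:~R.
  have -> : (fun y => star y (s y)) =
     (fun y => e *: lef_divpow (N%:Z - r) (u y)) :> section V.
    by apply: section_ext => y; exact: uf.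
  rewrite connectionZ; last exact: smooth_divpow.
  rewrite DsE /comb !linearD !linearZ /= a0f b0f b1f b2f.
  have -> : N%:Z - (N%:Z - r) = r by lia.
  have -> : N%:Z - 2 - (N%:Z - r - 1) = r - 1 by lia.
  have -> : N%:Z + 2 - (N%:Z - r + 1) = r + 1 by lia.
  rewrite !scalerA; congr (_ *: _ + _ *: _ + _ *: _ + _ *: _).
  - by rewrite mulr1.
  - by rewrite mulrN mulr1 e1.
  - by rewrite mulrAC e1 mul1r.
  rewrite mulrN mulrAC e1 mul1r -rmorphN; congr (_%:~R); ring.
have rhs1 : dual_lefschetz star x (theta s x v) = comb r 0 (N%:Z - r - 1)%:~R
    ((r + 1) * (N%:Z - r))%:~R ((r + 1) * (r + 2) * (N%:Z - r + 1))%:~R.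
  rewrite thsE thE !linearD !linearZ /=.
  rewrite (dual_lefschetz_divpow starP r eN1 b0f).
  rewrite (dual_lefschetz_divpow starP _ e1 b1f).
  rewrite (dual_lefschetz_divpow starP _ eN1 b2f) !addrK.
  rewrite /comb scale0r add0r !scalerA -!intrM.
  by congr (_%:~R *: _ + _%:~R *: _ + _%:~R *: _); ring.
have rhs2 : theta (fun y => dual_lefschetz star y (s y)) x v = comb r 0 (N%:Z - r + 1)%:~R
    (r * (N%:Z - r + 1))%:~R (r * (r + 1) * (N%:Z - r + 1))%:~R.
  have -> : (fun y => dual_lefschetz star y (s y)) =
     (fun y => (N%:Z - r + 1)%:~R *: lef_divpow (r - 1) (u y)) :> section V.
    by apply: section_ext => y; exact: LamE.
  rewrite thetaZ; last exact: smooth_divpow.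
  rewrite thsE thE !subrK /comb scale0r add0r !scalerDr !scalerA -!intrM.
  by congr (_%:~R *: _ + _%:~R *: _ + _%:~R *: _); ring.
have comb_sum a b c d b' c' d' b'' c'' d'' :
    comb r a b c d + (comb r 0 b' c' d' - comb r 0 b'' c'' d'') =
    comb r a (b + (b' - b'')) (c + (c' - c'')) (d + (d' - d'')).
  rewrite /comb !scale0r !add0r !opprD !scalerDl !scaleNr.
  by rewrite [LHS](AC (4*(3*3)) (1*(2*(5*8))*(3*(6*9))*(4*(7*10)))).
rewrite lhs DsE rhs1 rhs2 comb_sum.
by congr (comb _ _ _ _ _); rewrite ?rmorphM ?rmorphD ?rmorphN ?rmorph1 /=; ring.
Qed.

Lemma conjugation s x (v : tangent x) : smooth_section s ->
  star x (D (fun y => star y (s y)) x v) =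
  D s x v + (dual_lefschetz star x (theta s x v)
             - theta (fun y => dual_lefschetz star y (s y)) x v).
Proof.
move=> ss; suff [] : smooth_section s /\ star x (D (fun y => star y (s y)) x v) =
  D s x v + (dual_lefschetz star x (theta s x v)
             - theta (fun y => dual_lefschetz star y (s y)) x v) by [].
move: s ss; apply: smooth_lefschetz_ind => [s t [ss Es] [st Et]|k u r su up].
  split; first exact: (smooth_section_on_add openT ss st).
  have -> : (fun y => star y (s y + t y)) =
     (fun y => star y (s y) + star y (t y)) :> section V.
    by apply: section_ext => y; rewrite linearD.
  have -> : (fun y => dual_lefschetz star y (s y + t y)) = (fun y =>
     dual_lefschetz star y (s y) + dual_lefschetz star y (t y)) :> section V.
    by apply: section_ext => y; rewrite linearD.
  rewrite !connectionD ?thetaD ?thetaD //; try exact: smooth_star.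
  - rewrite [star x (_ + _)]linearD [dual_lefschetz star x (_ + _)]linearD /=.
    rewrite opprD Es Et.
    by rewrite [LHS](AC ((1*2)*(1*2)) ((1*4)*((2*5)*(3*6)))).
  - exact: smooth_dual_lefschetz.
  - exact: smooth_dual_lefschetz.
split; first exact: smooth_divpow.
exact: conjugation_divpow.
Qed.

End Connection.

Theorem theorem3p1 (R : realType) (m n : nat) (M : manifold R m)
    (V : lefschetz_bundle M n) (star : endo V) (D : operator V)
    (theta := brk_op_endo D (lef_op V))
    (Lambda := dual_lefschetz star) :
  lefschetz_star star ->
  connection D ->
  degree_preserving D ->
  op_eq (brk_endo_op (lef_op V) theta) (@op_zero R m M V) ->
  op_eq (endo_comp (endo_inv star) (comp_endo D star))
        (op_add D (brk_endo_op Lambda theta)).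
Proof.
move=> starP Dconn Ddeg Ltheta s ss x v.
rewrite /endo_comp /comp_endo /op_add /brk_endo_op /op_sub endo_inv_star //.
exact: conjugation.
Qed.
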